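(* Let $G$ be a finite group and let $I(G)$ denote the number of elements $g\in G$ such that $g^2=1$. Then $$\alpha(G)\le\frac12+\frac{I(G)}{2|G|},\qquad \frac{I(G)}{|G|}\ge 2\alpha(G)-1.$$ In particular, $\alpha(G)=1$ if and only if $G$ is an elementary abelian $2$-group.
   Context: For a finite group $G$, $c(G)$ denotes the number of cyclic subgroups of $G$ (including the trivial one) and $\alpha(G):=c(G)/|G|$. The trivial group is regarded as an elementary abelian $2$-group. *)

(* Defs.v *)
From mathcomp Require Import all_boot all_order all_fingroup all_algebra all_solvable.

Set Implicit Arguments.
Unset Strict Implicit.
Unset Printing Implicit Defensive.

Import GroupScope GRing.Theory.

Definition num_cyclic (gT : finGroupType) (G : {group gT}) : nat :=
  #|[set H in subgroups G | cyclic H]|.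

Definition alpha (gT : finGroupType) (G : {group gT}) : rat :=
  ((num_cyclic G)%:R / #|G|%:R)%R.

Definition num_sqr1 (gT : finGroupType) (G : {group gT}) : nat :=
  #|[set g in G | g ^+ 2 == 1]|.

(* Main.v *)
Require Import Defs.
From mathcomp Require Import all_boot all_order all_fingroup all_algebra all_solvable.
From mathcomp Require Import lra.

(** Sending g to the subgroup it generates maps G onto its set of cyclic
    subgroups, and the fibre over H is the set of generators of H. Weigh each
    g in G by 1, or by 2 when g ^+ 2 = 1; the total weight is #|G| plus the
    number of solutions of g ^+ 2 = 1. Every fibre has weight at least 2: a
    generator x either has weight 2 by itself, or is accompanied by the distinct
    generator x^-1. Summing over the fibres bounds twice the number of cyclic
    subgroups (lemma [double_num_cyclic_leq]), and both inequalities are this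
    bound divided by the order of G.

    The value 1 of alpha means that the map above is injective. As x and x^-1
    generate the same subgroup, this forces x ^+ 2 = 1 throughout G; conversely
    a cyclic group of order at most 2 has a single generator (lemma
    [num_cyclic_eq_card]). *)

Set Implicit Arguments.
Unset Strict Implicit.
Unset Printing Implicit Defensive.

Import GroupScope GRing.Theory Num.Theory.

Lemma cyclic_subgroups_imset (gT : finGroupType) (G : {group gT}) :
  [set H in subgroups G | cyclic H] = [set <[x]>%G | x in G].
Proof.
apply/setP=> H; rewrite !inE; apply/andP/imsetP.
  case=> sHG /cyclicP[x defH]; exists x; last exact: val_inj.
  by rewrite -cycle_subG -defH.
by case=> x Gx ->; rewrite cycle_subG Gx cycle_cyclic.
Qed.

Lemma sqr1_invg (gT : finGroupType) (x : gT) : (x ^+ 2 == 1) = (x^-1 == x).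
Proof. by rewrite expgS expg1 eq_sym eq_invg_mul. Qed.

Lemma cycle_groupV (gT : finGroupType) (x : gT) : <[x^-1]>%G = <[x]>%G.
Proof. by apply: val_inj; rewrite /= cycleV. Qed.

(** Each fibre of the map sending x to its cyclic subgroup contributes at least
    2 to the right-hand side. *)
Lemma double_num_cyclic_leq (gT : finGroupType) (G : {group gT}) :
  2 * num_cyclic G <= #|G| + num_sqr1 G.
Proof.
rewrite /num_cyclic /num_sqr1 cyclic_subgroups_imset.
set C := [set <[x]>%G | x in G].
have inC x : x \in G -> <[x]>%G \in C by apply: imset_f.
rewrite -[#|G|]sum1_card -[#|[set _ in _ | _]|]sum1_card.
rewrite (partition_big (fun x => <[x]>%G) (mem C)) //=.
rewrite [X in _ <= _ + X](partition_big (fun x => <[x]>%G) (mem C)) /=; last first.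
  by move=> x; rewrite inE => /andP[/inC].
rewrite -big_split /= mulnC -sum_nat_const; apply: leq_sum => _ /imsetP[x Gx ->].
have [x2 | nx2] := boolP (x ^+ 2 == 1).
  rewrite (bigD1 x) ?Gx ?eqxx //=.
  by rewrite [X in _ + X](bigD1 x) ?inE ?Gx ?x2 ?eqxx //= addnACA leq_addr.
rewrite (bigD1 x) ?Gx ?eqxx //= (bigD1 x^-1) /=; last first.
  by rewrite groupV Gx cycle_groupV eqxx -sqr1_invg.
by rewrite addnA -addnA leq_addr.
Qed.

(** Both sides say that an element of G is determined by the subgroup it
    generates. *)
Lemma num_cyclic_eq_card (gT : finGroupType) (G : {group gT}) :
  (num_cyclic G == #|G|) = 2.-abelem G.
Proof.
rewrite /num_cyclic cyclic_subgroups_imset.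
apply/imset_injP/idP => [injG | abG].
  apply/exponent2_abelem/exponentP => x Gx; apply/eqP; rewrite sqr1_invg.
  by apply/eqP/injG; rewrite ?groupV // cycle_groupV.
have [_ expG] := abelemP (isT : prime 2) abG.
move=> x y Gx Gy /(congr1 val) /= eqxy.
(* x lies in the cyclic group generated by y, so it is 1 or y. *)
have [y1 | nty] := eqVneq y 1.
  by apply/eqP; rewrite y1 -cycle_eq1 eqxy y1 cycle1.
have oy : #[y] = 2 by apply: nt_prime_order => //; apply: expG.
have: x \in <[y]> by rewrite -eqxy cycle_id.
rewrite cycle2g // !inE => /orP[] /eqP // x1.
by case/eqP: nty; apply/eqP; rewrite -cycle_eq1 -eqxy x1 cycle1.
Qed.

Theorem mainTheorem14 (gT : finGroupType) (G : {group gT}) :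
  [/\ (alpha G <= 1 / 2%:R + (num_sqr1 G)%:R / (2%:R * #|G|%:R))%R,
      ((num_sqr1 G)%:R / #|G|%:R >= 2%:R * alpha G - 1)%R
    & (alpha G = 1%R <-> (2.-abelem G)%g)].
Proof.
have oG_gt0 : (0 < #|G|%:R :> rat)%R by rewrite ltr0n cardG_gt0.
have oG_neq0 : (#|G|%:R != 0 :> rat)%R by apply: lt0r_neq0.
have bound : (2%:R * alpha G <= 1 + (num_sqr1 G)%:R / #|G|%:R)%R.
  rewrite /alpha mulrA -[X in (_ <= X + _)%R](divff oG_neq0) -mulrDl.
  by rewrite ler_pM2r ?invr_gt0 // -natrM -natrD ler_nat double_num_cyclic_leq.
split.
- rewrite invfM mulrCA; lra.
- lra.
- rewrite -num_cyclic_eq_card /alpha; split=> [/divr1_eq eqcG | /eqP->]; last exact: divff.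
  by rewrite -(eqr_nat rat) eqcG.
Qed.
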